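(* Assume $0<\theta<1$ and let $\varepsilon>0$ with $1/\varepsilon>r\bar x+y_2$. Let $(V^{(k)})_{k\ge0}$ be the sequence of grid functions generated by the downward Howard-Tarski-Kantorovich algorithm described in the context. Then $V^{(k)}$ converges, as $k\to\infty$, to the maximal solution $\overline V^{\varepsilon}$ of the regularized discrete HJB system (R).
   Context: Parameters: $\gamma>1$, $0<\psi<1$, $\rho>r>0$, $y_2>y_1>0$, $\lambda_1,\lambda_2>0$, and $\underline x$ with $\rho\underline x+y_1>0$. Set $\theta=\frac{1-\psi^{-1}}{1-\gamma}>0$, $b=\rho\left[\frac{r+\psi(\rho-r)}{\rho}\right]^{\frac1{1-\psi}}$, and $\bar\jmath=3-j$ for $j\in\{1,2\}$. For $c>0$, $v<0$: $\mathcal F(c,v)=\frac{\rho}{1-\psi^{-1}}\,c^{1-\psi^{-1}}\,((1-\gamma)v)^{1-\theta}$. Grid: $\underline x\le 0<\bar x$, $I\ge 1$ an integer, $\Delta x=(\bar x-\underline x)/I$, $x_i=\underline x+i\Delta x$ for $0\le i\le I$. A grid function is $V=(V_{i,j})_{0\le i\le I,\,j\in\{1,2\}}$; $U\preceq V$ means $U_{i,j}\le V_{i,j}$ for all $i,j$. $\Delta^+V_{i,j}=(V_{i+1,j}-V_{i,j})/\Delta x$ for $i<I$, $\Delta^-V_{i,j}=(V_{i,j}-V_{i-1,j})/\Delta x$ for $i>0$ (the values of $\Delta^+V_{I,j}$, $\Delta^-V_{0,j}$ are arbitrary and play no role). Put $\bar c_j(x)=rx+y_j$, $(z)_+=\max(z,0)$,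 $0^{-\psi}=+\infty$. Regularized Hamiltonian: for $v<0$ and reals $p^F,p^B$ let $c^F=\min\{\rho^\psi(p^F)_+^{-\psi}((1-\gamma)v)^{\frac{1-\gamma\psi}{1-\gamma}},\bar c_j(x_i)\}$ for $i<I$, $c^F=\bar c_j(\bar x)$ for $i=I$; $c^B=\max\{\min\{1/\varepsilon,\rho^\psi(p^B)_+^{-\psi}((1-\gamma)v)^{\frac{1-\gamma\psi}{1-\gamma}}\},\bar c_j(x_i)\}$ for $i>0$, $c^B=\bar c_j(\underline x)$ for $i=0$; and $$\boldsymbol H_\varepsilon(x_i,y_j,v,p^F,p^B)=(\bar c_j(x_i)-c^F)p^F+(\bar c_j(x_i)-c^B)p^B+\mathcal F(c^F,v)+\mathcal F(c^B,v)-\mathcal F(\bar c_j(x_i),v).$$ Barriers: $\check U_{i,1}=\check U_{i,2}=\frac{(rx_i+y_1)^{1-\gamma}}{1-\gamma}$, $\check V_{i,1}=\check V_{i,2}=\frac{(b(x_i+y_2/r))^{1-\gamma}}{1-\gamma}$. System (R): $\frac\rho\theta V_{i,j}=\boldsymbol H_\varepsilon(x_i,y_j,V_{i,j},\Delta^+V_{i,j},\Delta^-V_{i,j})+\lambda_j(V_{i,\bar\jmath}-V_{i,j})$ for all $0\le i\le I$, $j\in\{1,2\}$. A solution of (R) is a grid function $V^\varepsilon$ satisfying these equations and $\check U\preceq V^\varepsilon\preceq\check V$. The maximal solution $\overline V^\varepsilon$ is a solution such that $V^\varepsilon\preceq\overline V^\varepsilon$ for every solution $V^\varepsilon$. Algorithm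 (run without stopping tests). Set $V^{(0)}=\check V$. Given $V^{(k)}$, $V^{(k+1)}$ is the solution of $$\frac\rho\theta V^{(k+1)}_{i,j}=\boldsymbol H_\varepsilon(x_i,y_j,V^{(k)}_{i,j},\Delta^+V^{(k+1)}_{i,j},\Delta^-V^{(k+1)}_{i,j})+\lambda_j(V^{(k+1)}_{i,\bar\jmath}-V^{(k+1)}_{i,j})\quad\forall i,j,$$ computed as the limit as $n\to\infty$ of the inner Howard iterates: start from the policy $c^{F,(k,0)}_{i,j}=c^{B,(k,0)}_{i,j}=rx_i+y_j$; for $n=0,1,\dots$, with $s^{F,(k,n)}_{i,j}=\bar c_j(x_i)-c^{F,(k,n)}_{i,j}$ and $s^{B,(k,n)}_{i,j}=\bar c_j(x_i)-c^{B,(k,n)}_{i,j}$, let $V^{(k,n+1)}$ solve the linear system $$\frac\rho\theta V^{(k,n+1)}_{i,j}=s^{F,(k,n)}_{i,j}\Delta^+V^{(k,n+1)}_{i,j}+s^{B,(k,n)}_{i,j}\Delta^-V^{(k,n+1)}_{i,j}+\mathcal F(c^{F,(k,n)}_{i,j},V^{(k)}_{i,j})+\mathcal F(c^{B,(k,n)}_{i,j},V^{(k)}_{i,j})-\mathcal F(\bar c_j(x_i),V^{(k)}_{i,j})+\lambda_j(V^{(k,n+1)}_{i,\bar\jmath}-V^{(k,n+1)}_{i,j}),$$ and let $c^{F,(k,n+1)}_{i,j}=\min\{\rho^\psi(\Delta^+V^{(k,n+1)}_{i,j})_+^{-\psi}((1-\gamma)V^{(k)}_{i,j})^{\frac{1-\gamma\psi}{1-\gamma}},\bar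 c_j(x_i)\}$ for $i<I$, $c^{F,(k,n+1)}_{I,j}=\bar c_j(\bar x)$; $c^{B,(k,n+1)}_{i,j}=\max\{\min\{1/\varepsilon,\rho^\psi(\Delta^-V^{(k,n+1)}_{i,j})_+^{-\psi}((1-\gamma)V^{(k)}_{i,j})^{\frac{1-\gamma\psi}{1-\gamma}}\},\bar c_j(x_i)\}$ for $i>0$, $c^{B,(k,n+1)}_{0,j}=\bar c_j(\underline x)$. *)

(* Defs.v *)
From mathcomp Require Import all_boot all_order all_algebra.
From mathcomp Require Import all_classical all_reals all_analysis.

Set Implicit Arguments.
Unset Strict Implicit.
Unset Printing Implicit Defensive.

Import Order.TTheory GRing.Theory Num.Theory.
Import numFieldNormedType.Exports.
Local Open Scope classical_set_scope.
Local Open Scope ring_scope.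

(* The two income states 1, 2 are [ord0], [ord_max] : 'I_2, so the other state
   [3 - j] is [rev_ord j]; [nx] is the number I of grid cells. *)
Record model (R : realType) := Model {
  gamma : R;
  psi : R;
  rho : R;
  r : R;
  y : 'I_2 -> R;
  lambda : 'I_2 -> R;
  xlo : R;
  xhi : R;
  nx : nat
}.

Section Model.
Context {R : realType}.
Variable M : model R.

Definition theta : R := (1 - (psi M)^-1) / (1 - gamma M).

Definition b : R :=
  rho M * ((r M + psi M * (rho M - r M)) / rho M) `^ (1 - psi M)^-1.

Definition node := 'I_(nx M).+1.
Definition grid := node -> 'I_2 -> R.

Definition dx : R := (xhi M - xlo M) / (nx M)%:R.
Definition x (i : node) : R := xlo M + i%:R * dx.
Definition cbar (i : node) (j : 'I_2) : R := r M * x i + y M j.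

Definition gridle (U V : grid) : Prop := forall i j, U i j <= V i j.

Definition grid_cvg (V : nat -> grid) (W : grid) : Prop :=
  forall i j, V k i j @[k --> \oo] --> W i j.

(* [inord] sends out-of-range indices to 0, so [Dplus V] at the last node is a
   junk value, as is [Dminus V] at node 0 (where it is 0); both get multiplied
   by a zero drift. *)
Definition Dplus (V : grid) : grid :=
  fun i j => (V (inord i.+1) j - V i j) / dx.
Definition Dminus (V : grid) : grid :=
  fun i j => (V i j - V (inord i.-1) j) / dx.

(* Only meant for 0 < c and v < 0. *)
Definition F (c v : R) : R :=
  rho M / (1 - (psi M)^-1) * c `^ (1 - (psi M)^-1) *
  ((1 - gamma M) * v) `^ (1 - theta).

(* z^-psi for z >= 0, with 0^-psi = +oo (whereas [powR] gives 0 there). *)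
Definition pow_opp_psi (z : R) : \bar R :=
  if z == 0 then +oo%E else (z `^ (- psi M))%:E.

Definition cfoc (v p : R) : \bar R :=
  ((rho M `^ psi M)%:E * pow_opp_psi (Num.max p 0)%R *
   (((1 - gamma M) * v) `^ ((1 - gamma M * psi M) / (1 - gamma M)))%:E)%E.

(* The minima are never infinite, hence the [fine]. *)
Definition consF (i : node) (j : 'I_2) (v p : R) : R :=
  if (i < nx M)%N then fine (Order.min (cfoc v p) (cbar i j)%:E)
  else cbar i j.

Definition consB (eps : R) (i : node) (j : 'I_2) (v p : R) : R :=
  if (0 < i)%N then
    Num.max (fine (Order.min (eps^-1)%:E (cfoc v p))) (cbar i j)
  else cbar i j.

Definition H (eps : R) (i : node) (j : 'I_2) (v pF pB : R) : R :=
  let cF := consF i j v pF in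
  let cB := consB eps i j v pB in
  (cbar i j - cF) * pF + (cbar i j - cB) * pB
  + F cF v + F cB v - F (cbar i j) v.

Definition Ucheck : grid :=
  fun i _ => (r M * x i + y M ord0) `^ (1 - gamma M) / (1 - gamma M).
Definition Vcheck : grid :=
  fun i _ => (b * (x i + y M ord_max / r M)) `^ (1 - gamma M) / (1 - gamma M).

(* The equation whose unknown is [V], with [U] frozen in the [v]-slot of the
   Hamiltonian: the discrete HJB system is the case U = V, an outer step of the algorithm
   is the case where U is the current iterate. *)
Definition hjb_frozen (eps : R) (U V : grid) : Prop :=
  forall i j, rho M / theta * V i j =
    H eps i j (U i j) (Dplus V i j) (Dminus V i j)
    + lambda M j * (V i (rev_ord j) - V i j).

Definition solution (eps : R) (V : grid) : Prop :=
  [/\ hjb_frozen eps V V, gridle Ucheck V & gridle V Vcheck].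

Definition maximal_solution (eps : R) (V : grid) : Prop :=
  solution eps V /\ forall W, solution eps W -> gridle W V.

Definition howard_linear (U cF cB W : grid) : Prop :=
  forall i j, rho M / theta * W i j =
    (cbar i j - cF i j) * Dplus W i j + (cbar i j - cB i j) * Dminus W i j
    + F (cF i j) (U i j) + F (cB i j) (U i j) - F (cbar i j) (U i j)
    + lambda M j * (W i (rev_ord j) - W i j).

(* W n is meaningful for n >= 1 only: the iteration starts from the policy,
   not from a value. *)
Definition howard_iterates (eps : R) (U : grid) (W cF cB : nat -> grid)
    : Prop :=
  [/\ cF 0%N = cbar,
      cB 0%N = cbar,
      forall n, howard_linear U (cF n) (cB n) (W n.+1),
      forall n i j, cF n.+1 i j = consF i j (U i j) (Dplus (W n.+1) i j) &
      forall n i j, cB n.+1 i j = consB eps i j (U i j) (Dminus (W n.+1) i j)].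

Definition htk_step (eps : R) (U V : grid) : Prop :=
  hjb_frozen eps U V /\
  exists W cF cB, howard_iterates eps U W cF cB /\ grid_cvg W V.

Definition htk_sequence (eps : R) (V : nat -> grid) : Prop :=
  V 0%N = Vcheck /\ forall k, htk_step eps (V k) (V k.+1).

End Model.

(* Main.v *)
From HB Require Import structures.
Require Import Defs.
From mathcomp Require Import all_boot all_order all_algebra.
From mathcomp Require Import all_classical all_reals all_analysis.
From mathcomp Require Import ring lra.
Import Order.TTheory GRing.Theory Num.Theory.
Import numFieldNormedType.Exports.
Local Open Scope ring_scope.

Set Implicit Arguments.
Unset Strict Implicit.
Unset Printing Implicit Defensive.

(* Concavity of the flow utility in consumption makes the clipped first-order
   policy (c^F, c^B) a maximiser of drift + source over all admissible
   policies, so that the Hamiltonian is a supremum of affine monotone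
   operators.  A discrete maximum principle then gives comparison for the
   frozen equation, invertibility of the linear systems, and monotone
   convergence of Howard's iterates.  Since theta < 1, the source is
   nondecreasing in the frozen value, so one outer step T is monotone; the
   barriers satisfy Ucheck <= T Ucheck and T Vcheck <= Vcheck, hence the
   iterates decrease from Vcheck and stay above Ucheck.  Their limit is a fixed
   point of T, and any solution W satisfies W = T^k W <= T^k Vcheck for all k. *)

(** * Power functions *)

Section PowerInequalities.
Local Open Scope classical_set_scope.
Context {R : realType}.
Implicit Types (a c e p t : R).

(** Convexity of a power with nonpositive exponent. Writing [c = a * t] reduces it to
    [1 + e * (t - 1) <= expR (e * ln t)], which follows from [1 + s <= expR s] and [ln t <= t - 1],
    the latter reversed by the sign of [e]. *)
Lemma powR_tangent e a c : e <= 0 -> 0 < a -> 0 < c ->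
  a `^ e + e * a `^ (e - 1) * (c - a) <= c `^ e.
Proof.
move=> e0 a0 c0; set t := c / a.
have t0 : 0 < t by rewrite divr_gt0.
have a_neq0 : a != 0 by rewrite gt_eqF.
have -> : c = a * t by rewrite /t mulrC divfK.
have ae : a `^ e = a * a `^ (e - 1).
  by rewrite powRB ?a_neq0 ?implybT// powRr1 ?ltW// mulrC divfK.
rewrite (powRM _ (ltW a0) (ltW t0)).
have -> : a `^ e + e * a `^ (e - 1) * (a * t - a) = a `^ e * (1 + e * (t - 1)).
  by rewrite ae; ring.
rewrite ler_pM2l ?powR_gt0//.
rewrite /powR gt_eqF//.
apply: le_trans (expR_ge1Dx _).
rewrite lerD2l ler_wnM2l//.
have -> : ln t = ln (1 + (t - 1)) by rewrite addrC subrK.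
by apply: le_ln1Dx; lra.
Qed.

(** Young's inequality for the product of [t ^ p] and 1, with conjugate exponents [1/p] and
    [1/(1-p)]. It serves to compare [r] with [b]. *)
Lemma powR_le_chord p t : 0 < p < 1 -> 0 <= t -> t `^ p <= p * t + (1 - p).
Proof.
move=> /andP[p0 p1] t0.
have q0 : 0 < 1 - p by lra.
have := @conjugate_powR _ (t `^ p) 1 p^-1 (1 - p)^-1 (powR_ge0 _ _) ler01.
rewrite !invr_gt0 !invrK => /(_ p0 q0) /=.
rewrite addrC subrK powR1 mulr1 mul1r -powRrM mulfV ?gt_eqF// powRr1// mulrC.
by apply.
Qed.

Lemma nonincreasing_powR e a c : e <= 0 -> 0 < a -> a <= c -> c `^ e <= a `^ e.
Proof.
move=> e0 a0 ac; have c0 := lt_le_trans a0 ac.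
rewrite -[e]opprK [leLHS]powRN [leRHS]powRN lef_pV2 ?posrE ?powR_gt0//.
by apply: ge0_ler_powR => //; rewrite ?oppr_ge0// nnegrE ltW.
Qed.

Lemma continuous_powR p a : 0 < a -> {for a, continuous (fun t : R => t `^ p)}.
Proof.
move=> a0; apply: differentiable_continuous; apply/derivable1_diffP.
by apply: derivable_powR; rewrite in_itv/= a0.
Qed.

Lemma cvg_mul_bounded0 (u v : R^nat) (C : R) :
  (forall n, `|u n| <= C) -> v n @[n --> \oo] --> 0 ->
  u n * v n @[n --> \oo] --> 0.
Proof.
move=> uC v0; apply/norm_cvg0P.
apply: (@squeeze_cvgr _ _ _ _ (cst 0) (fun n => C * `|v n|)).
- by apply: nearW => n; rewrite normr_ge0 normrM ler_wpM2r.
- exact: cvg_cst.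
- by rewrite -(mulr0 C); apply: cvgMl_tmp; apply/norm_cvg0P.
Qed.
End PowerInequalities.

(** * Optimal policies *)

Section HTK.
Local Open Scope classical_set_scope.
Context {R : realType}.
Variables (M : model R) (eps : R).
Hypothesis hgamma : 1 < gamma M.
Hypothesis hpsi : 0 < psi M < 1.
Hypothesis hr : 0 < r M < rho M.
Hypothesis hy : 0 < y M ord0 < y M ord_max.
Hypothesis hlambda : forall j, 0 < lambda M j.
Hypothesis hxlo : 0 < rho M * xlo M + y M ord0.
Hypothesis hx : xlo M <= 0 < xhi M.
Hypothesis hnx : (1 <= nx M)%N.
Hypothesis htheta : 0 < theta M < 1.
Hypothesis heps : 0 < eps.
Hypothesis heps_inv : r M * xhi M + y M ord_max < eps^-1.

Implicit Types (i : node M) (j : 'I_2) (U V W : grid M) (c v p : R).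

Local Notation e := (1 - (psi M)^-1).
Local Notation q := (1 - theta M).
Local Notation w v := ((1 - gamma M) * v).
Local Notation kappa := (rho M / theta M).

Let e_lt0 : e < 0.
Proof. by case/andP: hpsi => p0 p1; rewrite subr_lt0 invf_gt1. Qed.

Let psi_neq0 : psi M != 0.
Proof. by case/andP: hpsi => p0 _; rewrite gt_eqF. Qed.

Let psi1_neq0 : psi M - 1 != 0.
Proof. by case/andP: hpsi => _ p1; rewrite subr_eq0 lt_eqF. Qed.

Let rho_gt0 : 0 < rho M. Proof. by case/andP: hr => r0; apply: lt_trans. Qed.

Let q_gt0 : 0 < q. Proof. by rewrite subr_gt0; case/andP: htheta. Qed.

Let kappa_gt0 : 0 < kappa.
Proof. by rewrite divr_gt0//; case/andP: htheta. Qed.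

Let w_gt0 v : v < 0 -> 0 < w v.
Proof. by move=> v0; rewrite nmulr_lgt0// subr_lt0. Qed.

Let K_lt0 : rho M / e < 0.
Proof. by rewrite pmulr_rlt0// invr_lt0. Qed.

Lemma F_homo c c' v : 0 < c -> c <= c' -> F M c v <= F M c' v.
Proof.
move=> c0 cc'; rewrite /F -[leLHS]mulrA -[leRHS]mulrA ler_wnM2l ?(ltW K_lt0)//.
by rewrite ler_wpM2r ?powR_ge0// nonincreasing_powR// ltW.
Qed.

(* The derivative of [c |-> F M c v]. *)
Definition marginal c v : R := rho M * c `^ (- (psi M)^-1) * w v `^ q.

Lemma marginal_anti c c' v : 0 < c -> c <= c' -> marginal c' v <= marginal c v.
Proof.
move=> c0 cc'; rewrite ler_wpM2r ?powR_ge0// ler_wpM2l ?(ltW rho_gt0)//.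
by rewrite nonincreasing_powR// oppr_le0 invr_ge0; case/andP: hpsi => /ltW.
Qed.

(** Concavity in consumption: [powR_tangent] is multiplied by the negative constant [rho M / e],
    which reverses it. *)
Lemma F_tangent a c v : 0 < a -> 0 < c ->
  F M c v <= F M a v + marginal a v * (c - a).
Proof.
move=> a0 c0.
have := powR_tangent (ltW e_lt0) a0 c0.
rewrite (_ : e - 1 = - (psi M)^-1); last by ring.
move=> /(ler_wnM2l (ltW K_lt0)) /(ler_wpM2r (powR_ge0 (w v) q)).
congr (_ <= _); rewrite /F /marginal.
by field; rewrite psi_neq0.
Qed.

(* First-order optimality over an interval: [p] is the slope of [F] at [a],
   unless [a] is an endpoint. *)
Lemma F_sub_linear_le a c v p : 0 < a -> 0 < c ->
  (a < c -> marginal a v <= p) -> (c < a -> p <= marginal a v) ->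
  F M c v - c * p <= F M a v - a * p.
Proof.
move=> a0 c0 hac hca; have := F_tangent v a0 c0.
by case: (ltgtP a c) => [/[dup]ac/hac|/[dup]ca/hca|<-//] ?; nra.
Qed.

Lemma cfoc_le0 v p : v < 0 -> p <= 0 -> cfoc M v p = +oo%E.
Proof.
move=> v0 p0; rewrite /cfoc /pow_opp_psi max_r// eqxx.
rewrite gt0_muley ?lte_fin ?powR_gt0//.
by rewrite gt0_mulye// lte_fin powR_gt0// w_gt0.
Qed.

(** For a positive slope the first-order consumption is finite and inverts the marginal utility.
    This is how optimality of the clipped policies becomes accessible to [F_sub_linear_le]. *)
Lemma cfoc_gt0 v p : v < 0 -> 0 < p ->
  exists2 c, cfoc M v p = c%:E & 0 < c /\ marginal c v = p.
Proof.
move=> v0 p0; rewrite /cfoc /pow_opp_psi max_l ?(ltW p0)// gt_eqF//.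
rewrite -!EFinM; eexists; first by [].
have wv0 := w_gt0 v0.
have g0 : 1 - gamma M != 0 by rewrite lt_eqF// subr_lt0.
split; first by rewrite !mulr_gt0// powR_gt0.
(* In this form, raising to the power [-1/psi] turns the exponent into [-q], which cancels the
   factor [w v ^ q] of [marginal]. *)
rewrite (_ : (1 - gamma M * psi M) / (1 - gamma M) = psi M * q); last first.
  by rewrite /theta; field; rewrite g0.
rewrite /marginal; move: (w v) wv0 => z z0.
rewrite !powRM ?mulr_ge0 ?powR_ge0// -!powRrM.
rewrite (_ : psi M * - (psi M)^-1 = - 1); last by field.
rewrite (_ : - psi M * - (psi M)^-1 = 1); last by field.
rewrite (_ : psi M * q * - (psi M)^-1 = - q); last by field.
rewrite powRr1 ?(ltW p0)// powR_inv1 ?(ltW rho_gt0)// powRN.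
field; rewrite !gt_eqF//= ?powR_gt0//.
Qed.

(** * Bounds on nodes, incomes and policies *)

Let dx_gt0 : 0 < dx M.
Proof.
rewrite divr_gt0 ?ltr0n// subr_gt0.
by case/andP: hx => /le_lt_trans; apply.
Qed.

Lemma x_ge i : xlo M <= x i.
Proof. by rewrite lerDl mulr_ge0// ltW. Qed.

Lemma x_le i : x i <= xhi M.
Proof.
rewrite /x -lerBrDl.
have -> : xhi M - xlo M = (nx M)%:R * dx M.
  by rewrite /dx mulrC divfK// pnatr_eq0 -lt0n.
by rewrite ler_wpM2r ?(ltW dx_gt0)// ler_nat -ltnS.
Qed.

Lemma y_bounds j : y M ord0 <= y M j <= y M ord_max.
Proof.
case/andP: hy => _ /ltW ?.
have [->|->] : j = ord0 \/ j = ord_max; last 2 first.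
- by rewrite lexx.
- by rewrite lexx andbT.
by case: j => -[|[|//]] ?; [left|right]; apply: val_inj.
Qed.

(** The hypothesis involves [rho], but [xlo <= 0] and [r < rho] give [rho * xlo <= r * xlo]. *)
Lemma rx_y0_gt0 i : 0 < r M * x i + y M ord0.
Proof.
case/andP: hr => r0 rrho; case/andP: hx => xlo0 _.
have := ler_wpM2l (ltW r0) (x_ge i).
have : rho M * xlo M <= r M * xlo M by rewrite ler_wnM2r// ltW.
by move: hxlo; lra.
Qed.

Lemma cbar_gt0 i j : 0 < cbar i j.
Proof.
apply: lt_le_trans (rx_y0_gt0 i) _.
by rewrite lerD2l; case/andP: (y_bounds j).
Qed.

Lemma cbar_lt i j : cbar i j < eps^-1.
Proof.
apply: le_lt_trans heps_inv; rewrite lerD//; last by case/andP: (y_bounds j).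
by rewrite ler_wpM2l ?x_le//; case/andP: hr => /ltW.
Qed.

(** The two disjunctions encode the state constraint: at an end of the grid the drift pointing
    outwards vanishes, and with it the weight of the junk difference there. *)
Definition admissible i j (cF cB : R) :=
  [/\ 0 < cF <= cbar i j, cbar i j <= cB <= eps^-1,
      (i < nx M)%N || (cF == cbar i j) & (0 < i)%N || (cB == cbar i j)].

Lemma admissible_cbar i j : admissible i j (cbar i j) (cbar i j).
Proof. by rewrite /admissible cbar_gt0 lexx !eqxx !orbT (ltW (cbar_lt i j)). Qed.

Lemma consFE i j v p : v < 0 -> (i < nx M)%N ->
  consF i j v p = if cfoc M v p is c%:E then Num.min c (cbar i j) else cbar i j.
Proof.
move=> v0 inx; rewrite /consF inx; case: (ltP 0 p) => p0.
  have [c -> _] := cfoc_gt0 v0 p0.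
  by rewrite -EFin_min.
by rewrite cfoc_le0// min_r// leey.
Qed.

Lemma consBE i j v p : v < 0 -> (0 < i)%N ->
  consB eps i j v p =
  if cfoc M v p is c%:E then Num.max (Num.min eps^-1 c) (cbar i j) else eps^-1.
Proof.
move=> v0 i0; rewrite /consB i0; case: (ltP 0 p) => p0.
  have [c -> _] := cfoc_gt0 v0 p0.
  by rewrite -EFin_min.
by rewrite cfoc_le0// min_l ?leey//= max_l// ltW// cbar_lt.
Qed.

Lemma admissible_cons i j v pF pB : v < 0 ->
  admissible i j (consF i j v pF) (consB eps i j v pB).
Proof.
move=> v0; have cb0 := cbar_gt0 i j; have cbe := ltW (cbar_lt i j).
split.
- case: (boolP (i < nx M)%N) => inx; last by rewrite /consF (negbTE inx) cb0/=.
  rewrite consFE//; case: (ltP 0 pF) => p0.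
    have [c -> [c0 _]] := cfoc_gt0 v0 p0.
    by rewrite lt_min c0 cb0/= ge_min lexx orbT.
  by rewrite cfoc_le0// cb0/=.
- case: (boolP (0 < i)%N) => i0; last by rewrite /consB (negbTE i0) lexx.
  rewrite consBE//; case: (ltP 0 pB) => p0.
    have [c -> [c0 _]] := cfoc_gt0 v0 p0.
    by rewrite le_max lexx orbT/= ge_max cbe andbT ge_min lexx.
  by rewrite cfoc_le0// cbe/=.
- by case: (boolP (i < nx M)%N) => // inx; rewrite /consF (negbTE inx) eqxx.
- by case: (boolP (0 < i)%N) => // i0; rewrite /consB (negbTE i0) eqxx.
Qed.

(** If [p <= 0], both [F] and [- c * p] increase with [c], so the upper endpoint [cbar] is best.
    Otherwise the clipped inverse of [marginal] meets the first-order conditions. *)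
Lemma consF_optimal i j v p c : v < 0 -> 0 < c <= cbar i j ->
  (i < nx M)%N || (c == cbar i j) ->
  F M c v - c * p <= F M (consF i j v p) v - consF i j v p * p.
Proof.
move=> v0 /andP[c0 cle]; case: (boolP (i < nx M)%N) => /= inx; last first.
  by move=> /eqP ->; rewrite /consF (negbTE inx).
move=> _; rewrite consFE//; case: (ltP 0 p) => p0; last first.
  rewrite cfoc_le0// lerB ?F_homo// ler_wnM2r//.
have [a -> [a0 ma]] := cfoc_gt0 v0 p0.
apply: F_sub_linear_le => //; first by rewrite lt_min a0 cbar_gt0.
  case: (leP a (cbar i j)) => ?; first by rewrite ma.
  by move=> /lt_le_trans/(_ cle); rewrite ltxx.
by move=> _; rewrite -ma marginal_anti ?ge_min ?lexx// lt_min a0 cbar_gt0.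
Qed.

(** Same argument on the interval from [cbar] to [eps^-1]; the cap provides the maximiser when
    [p <= 0]. *)
Lemma consB_optimal i j v p c : v < 0 -> cbar i j <= c <= eps^-1 ->
  (0 < i)%N || (c == cbar i j) ->
  F M c v - c * p <= F M (consB eps i j v p) v - consB eps i j v p * p.
Proof.
move=> v0 /andP[cge cle]; have cb0 := cbar_gt0 i j; have c0 := lt_le_trans cb0 cge.
case: (boolP (0 < i)%N) => /= i0; last first.
  by move=> /eqP ->; rewrite /consB (negbTE i0).
move=> _; rewrite consBE//; case: (ltP 0 p) => p0; last first.
  by rewrite cfoc_le0// lerB ?F_homo// ler_wnM2r.
have [a -> [a0 ma]] := cfoc_gt0 v0 p0.
have m0 : 0 < Num.min eps^-1 a by rewrite lt_min a0 (lt_le_trans c0 cle).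
apply: F_sub_linear_le => //; first by rewrite lt_max m0.
  case: (leP eps^-1 a) => ea.
    by rewrite max_l ?(ltW (cbar_lt _ _))// ltNge cle.
  by move=> _; rewrite -ma marginal_anti// le_max lexx.
case: (leP (Num.min eps^-1 a) (cbar i j)) => [_|]; first by rewrite ltNge cge.
by move=> _ _; rewrite -ma marginal_anti// ge_min lexx orbT.
Qed.

(** * Comparison and linear systems *)

Definition drift W i j (cF cB : R) : R :=
  (cbar i j - cF) * Dplus W i j + (cbar i j - cB) * Dminus W i j
  + lambda M j * (W i (rev_ord j) - W i j).

Definition source i j v (cF cB : R) : R :=
  F M cF v + F M cB v - F M (cbar i j) v.

Definition optF U W : grid M := fun i j => consF i j (U i j) (Dplus W i j).
Definition optB U W : grid M := fun i j => consB eps i j (U i j) (Dminus W i j).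

Lemma howard_linearE U cF cB W : howard_linear U cF cB W <->
  forall i j, kappa * W i j = drift W i j (cF i j) (cB i j)
                              + source i j (U i j) (cF i j) (cB i j).
Proof.
by split=> h i j; rewrite h /drift /source; ring.
Qed.

Lemma hjb_frozenE U V : hjb_frozen eps U V <->
  forall i j, kappa * V i j = drift V i j (optF U V i j) (optB U V i j)
                              + source i j (U i j) (optF U V i j) (optB U V i j).
Proof.
by split=> h i j; rewrite h /H /drift /source /optF /optB; ring.
Qed.

Lemma admissible_opt U W i j : U i j < 0 ->
  admissible i j (optF U W i j) (optB U W i j).
Proof. exact: admissible_cons. Qed.

Lemma opt_optimal U W i j cF cB : U i j < 0 -> admissible i j cF cB ->
  drift W i j cF cB + source i j (U i j) cF cB <=
  drift W i j (optF U W i j) (optB U W i j)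
  + source i j (U i j) (optF U W i j) (optB U W i j).
Proof.
move=> U0 [hF hB hF' hB'].
have := consF_optimal (Dplus W i j) U0 hF hF'.
have := consB_optimal (Dminus W i j) U0 hB hB'.
by rewrite /drift /source /optF /optB; lra.
Qed.

Lemma sourceE i j v cF cB : source i j v cF cB =
  rho M / e * (cF `^ e + cB `^ e - cbar i j `^ e) * w v `^ q.
Proof. by rewrite /source /F; ring. Qed.

Lemma source_coef_ge0 i j cF cB : admissible i j cF cB ->
  0 <= cF `^ e + cB `^ e - cbar i j `^ e.
Proof.
case=> /andP[cF0 cFle] _ _ _.
have := nonincreasing_powR (ltW e_lt0) cF0 cFle.
have := powR_ge0 cB e.
lra.
Qed.

Lemma source_le0 i j v cF cB : admissible i j cF cB -> source i j v cF cB <= 0.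
Proof.
move=> adm; rewrite sourceE -mulrA mulr_le0_ge0 ?(ltW K_lt0)//.
by rewrite mulr_ge0 ?powR_ge0// source_coef_ge0.
Qed.

(* This is where [theta M < 1] enters. *)
Lemma source_homo i j v v' cF cB : admissible i j cF cB -> v <= v' -> v' < 0 ->
  source i j v cF cB <= source i j v' cF cB.
Proof.
move=> adm vv' v'0; rewrite !sourceE ler_wnM2l//.
  by rewrite mulr_le0_ge0 ?(ltW K_lt0)// source_coef_ge0.
have wle : w v' <= w v by rewrite ler_wnM2l// subr_le0 ltW.
apply: ge0_ler_powR wle; first exact: ltW.
  by rewrite nnegrE ltW// w_gt0.
by rewrite nnegrE ltW// w_gt0// (le_lt_trans vv').
Qed.

(** At a maximiser of [Z] the forward difference is nonpositive, the backward one nonnegative and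
    the switching term nonpositive, so the upwind signs of the drifts make the whole right-hand side
    nonpositive. *)
Lemma maximum_principle Z (cF cB : grid M) :
  (forall i j, cF i j <= cbar i j <= cB i j) ->
  (forall i j, kappa * Z i j <= drift Z i j (cF i j) (cB i j)) ->
  forall i j, Z i j <= 0.
Proof.
move=> hc hZ i0 j0.
pose P := [pred k : node M * 'I_2 | true].
have [[i j] _ Zmax] := @arg_maxP _ _ _ (i0, j0) P (fun k => Z k.1 k.2) isT.
apply: le_trans (Zmax (i0, j0) isT) _ => /=.
have {}Zmax i' j' : Z i' j' <= Z i j by exact: (Zmax (i', j') isT).
rewrite -(pmulr_rle0 _ kappa_gt0); apply: le_trans (hZ i j) _.
have /andP[hF hB] := hc i j.
(* [inord] always returns some node, so both signs also hold at the ends of the grid. *)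
have hP : Dplus Z i j <= 0 by rewrite pmulr_lle0 ?invr_gt0// subr_le0.
have hM : 0 <= Dminus Z i j by rewrite divr_ge0 ?(ltW dx_gt0)// subr_ge0.
have hl : lambda M j * (Z i (rev_ord j) - Z i j) <= 0.
  by rewrite pmulr_rle0// subr_le0.
by rewrite /drift; nra.
Qed.

Lemma driftB W W' i j cF cB :
  drift (fun i j => W i j - W' i j) i j cF cB
  = drift W i j cF cB - drift W' i j cF cB.
Proof. by rewrite /drift /Dplus /Dminus; ring. Qed.

Lemma linear_comparison U U' W W' (cF cB : grid M) :
  (forall i j, admissible i j (cF i j) (cB i j)) ->
  gridle U U' -> (forall i j, U' i j < 0) ->
  (forall i j, kappa * W i j <= drift W i j (cF i j) (cB i j)
                                + source i j (U i j) (cF i j) (cB i j)) ->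
  (forall i j, drift W' i j (cF i j) (cB i j)
               + source i j (U' i j) (cF i j) (cB i j) <= kappa * W' i j) ->
  gridle W W'.
Proof.
move=> adm UU' U'0 hW hW' i j; rewrite -subr_le0.
apply: (@maximum_principle (fun i j => W i j - W' i j) cF cB) => {i j} i j.
  by case: (adm i j) => /andP[_ ->] /andP[->].
rewrite driftB mulrBr.
have := source_homo (adm i j) (UU' i j) (U'0 i j).
by have := hW i j; have := hW' i j; lra.
Qed.

(** The policy optimal for [W] is used on both sides: [W'] is a supersolution for every admissible
    policy, hence for this one, and the linear comparison applies. *)
Lemma frozen_comparison U U' W W' :
  gridle U U' -> (forall i j, U' i j < 0) ->
  (forall i j, kappa * W i j <=
     drift W i j (optF U W i j) (optB U W i j)
     + source i j (U i j) (optF U W i j) (optB U W i j)) ->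
  (forall i j cF cB, admissible i j cF cB ->
     drift W' i j cF cB + source i j (U' i j) cF cB <= kappa * W' i j) ->
  gridle W W'.
Proof.
move=> UU' U'0 hW hW'.
have adm i j : admissible i j (optF U W i j) (optB U W i j).
  by apply: admissible_opt; exact: le_lt_trans (U'0 i j).
by apply: (linear_comparison adm UU' U'0 hW) => i j; exact: hW'.
Qed.

Lemma hjb_frozen_supersolution U V i j cF cB : U i j < 0 ->
  hjb_frozen eps U V -> admissible i j cF cB ->
  drift V i j cF cB + source i j (U i j) cF cB <= kappa * V i j.
Proof. by move=> U0 /hjb_frozenE -> /opt_optimal; apply. Qed.

Lemma hjb_frozen_homo U U' V V' : gridle U U' -> (forall i j, U' i j < 0) ->
  hjb_frozen eps U V -> hjb_frozen eps U' V' -> gridle V V'.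
Proof.
move=> UU' U'0 /hjb_frozenE hV hV'; apply: (frozen_comparison UU' U'0).
  by move=> i j; rewrite hV.
by move=> i j cF cB; exact: hjb_frozen_supersolution.
Qed.

Lemma gridle_anti U V : gridle U V -> gridle V U -> U = V.
Proof.
move=> UV VU; apply/funext => i; apply/funext => j; apply/eqP.
by rewrite eq_le UV VU.
Qed.

Lemma hjb_frozen_uniq U V V' : (forall i j, U i j < 0) ->
  hjb_frozen eps U V -> hjb_frozen eps U V' -> V = V'.
Proof. by move=> U0 hV hV'; apply: gridle_anti; apply: hjb_frozen_homo U0 _ _. Qed.

(** In finite dimension injectivity suffices; it follows from the maximum principle applied to the
    difference of two grids with the same image and to its opposite. *)
Lemma linear_solvable (cF cB f : grid M) :
  (forall i j, cF i j <= cbar i j <= cB i j) ->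
  exists W, forall i j,
    kappa * W i j = drift W i j (cF i j) (cB i j) + f i j.
Proof.
move=> hc; pose T := {ffun node M * 'I_2 -> R^o}.
pose gr (h : T) : grid M := fun i j => h (i, j).
pose A (h : T) : T := [ffun k =>
  kappa * gr h k.1 k.2 - drift (gr h) k.1 k.2 (cF k.1 k.2) (cB k.1 k.2)].
have linA : linear A.
  move=> a h h'; apply/ffunP => -[i j].
  rewrite !ffunE /= /drift /Dplus /Dminus /gr !ffunE /=.
  by rewrite /GRing.scale/=; ring.
pose AL : {linear T -> T} := HB.pack A (GRing.isLinear.Build R T T *:%R A linA).
have kerA : lker (linfun AL) == 0%VS.
  apply/lker0P => h h'; rewrite !lfunE /= => hh'.
  have hZ i j : kappa * gr (h - h') i j =
      drift (gr (h - h')) i j (cF i j) (cB i j).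
    have := congr1 (fun g : T => g (i, j)) hh'.
    rewrite !ffunE /= /drift /Dplus /Dminus /gr !ffunE /=.
    lra.
  have Z0 : forall i j, gr (h - h') i j <= 0.
    by apply: (maximum_principle hc) => i j; rewrite hZ.
  have Z0' : forall i j, - gr (h - h') i j <= 0.
    apply: (@maximum_principle (fun i j => - gr (h - h') i j) _ _ hc) => i j.
    rewrite mulrN hZ /drift /Dplus /Dminus; lra.
  apply/ffunP => -[i j]; apply/eqP; rewrite eq_le -[_ <= h' _]subr_le0.
  have := Z0 i j; have := Z0' i j; rewrite /gr !ffunE => ? ->/=; lra.
pose W := ((linfun AL)^-1)%VF [ffun k => f k.1 k.2].
exists (gr W) => i j.
have : A W = [ffun k => f k.1 k.2] by rewrite -[A W](lfunE AL) lker0_lfunVK.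
move=> /(congr1 (fun g : T => g (i, j))); rewrite !ffunE /= => <-.
by rewrite addrC subrK.
Qed.

(** * Howard's algorithm *)

Lemma grid_cvg_comb (V : nat -> grid M) W (u : R^nat) (l : R) i i' j j' :
  grid_cvg V W -> u n @[n --> \oo] --> l ->
  (V n i j - V n i' j') * u n @[n --> \oo] --> (W i j - W i' j') * l.
Proof. by move=> VW ul; apply: cvgM => //; apply: cvgB; apply: VW. Qed.

(** The policies need not converge: admissibility bounds the drifts by [cbar] and [eps^-1], and the
    differences of [Z] tend to 0. *)
Lemma cvg_drift0 (Z : nat -> grid M) i j (cF cB : R^nat) :
  (forall n, admissible i j (cF n) (cB n)) -> grid_cvg Z (fun _ _ => 0) ->
  drift (Z n) i j (cF n) (cB n) @[n --> \oo] --> 0.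
Proof.
move=> adm Z0.
have D0 i' j' i'' j'' a : (Z n i' j' - Z n i'' j'') * a @[n --> \oo] --> 0.
  rewrite -[X in _ --> X](mul0r a) -[0 in X in _ --> X](subrr 0).
  by apply: grid_cvg_comb Z0 _; exact: cvg_cst.
rewrite -[X in _ --> X](addr0 0) -[X in _ --> X + _](addr0 0).
apply: cvgD; first apply: cvgD.
- apply: (@cvg_mul_bounded0 _ _ _ (cbar i j)); last exact: D0.
  by move=> n; have [/andP[? ?] _ _ _] := adm n; rewrite ger0_norm; lra.
- apply: (@cvg_mul_bounded0 _ _ _ eps^-1); last exact: D0.
  move=> n; have [_ /andP[? ?] _ _] := adm n; have := cbar_gt0 i j.
  by rewrite ler0_norm; lra.
- by under eq_fun do rewrite mulrC; exact: D0.
Qed.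

Lemma driftZ W a i j cF cB :
  drift (fun i j => W i j * a) i j cF cB = drift W i j cF cB * a.
Proof. by rewrite /drift /Dplus /Dminus; ring. Qed.

Lemma cvg_powR (u : R^nat) (l a : R) : 0 < l ->
  u n @[n --> \oo] --> l -> u n `^ a @[n --> \oo] --> l `^ a.
Proof.
move=> l0 ul.
exact: (cvg_comp u (fun t : R => t `^ a) ul (continuous_powR (p := a) l0)).
Qed.

Lemma hjb_frozen_limit (Un Wn Wn' : nat -> grid M) U W :
  (forall n i j, Un n i j < 0) -> (forall i j, U i j < 0) ->
  grid_cvg Un U -> grid_cvg Wn W -> grid_cvg Wn' W ->
  (forall n i j, kappa * Wn n i j =
     drift (Wn n) i j (optF (Un n) (Wn' n) i j) (optB (Un n) (Wn' n) i j)
     + source i j (Un n i j) (optF (Un n) (Wn' n) i j) (optB (Un n) (Wn' n) i j)) ->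
  hjb_frozen eps U W.
Proof.
move=> Un0 U0 UnU WnW Wn'W hW; apply/hjb_frozenE => i j.
pose cF n := optF (Un n) (Wn' n) i j; pose cB n := optB (Un n) (Wn' n) i j.
have adm n : admissible i j (cF n) (cB n) by exact: admissible_opt.
have adm' : admissible i j (optF U W i j) (optB U W i j) by exact: admissible_opt.
have diff0 (V V' : nat -> grid M) : grid_cvg V W -> grid_cvg V' W ->
    grid_cvg (fun n i j => V n i j - V' n i j) (fun _ _ => 0).
  by move=> VW V'W i' j'; rewrite -(subrr (W i' j')); apply: cvgB.
have cstW : grid_cvg (fun=> W) W by move=> i' j'; exact: cvg_cst.
have wcvg : w (Un n i j) @[n --> \oo] --> w (U i j) by apply: cvgMl_tmp; exact: UnU.
have kW : kappa * Wn n i j @[n --> \oo] --> kappa * W i j.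
  by apply: cvgMl_tmp; exact: WnW.
apply/eqP; rewrite eq_le; apply/andP; split.
- (* The source at [U] is the source at [Un n] times a ratio tending to 1, so
     no lower bound on the consumption policies is needed. *)
  pose d n := (w (U i j) `^ q) / (w (Un n i j) `^ q) - 1.
  have d0 : d n @[n --> \oo] --> 0.
    have wq0 : w (U i j) `^ q != 0 by rewrite gt_eqF ?powR_gt0 ?w_gt0.
    rewrite -(subrr (w (U i j) `^ q / w (U i j) `^ q)) {2}mulfV//.
    apply: cvgB; last exact: cvg_cst.
    apply: cvgMl_tmp; apply: cvgV => //.
    by apply: cvg_powR => //; exact: w_gt0.
  (* The difference of sources is [d n] times the source at [Un n]; the equation for [Wn n] trades
     that source for value minus drift, and linearity of the drift absorbs [d n]. *)
  have sE n : source i j (U i j) (cF n) (cB n) - source i j (Un n i j) (cF n) (cB n)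
      = kappa * Wn n i j * d n
        - drift (fun i j => Wn n i j * d n) i j (cF n) (cB n).
    rewrite driftZ -mulrBl hW -/(cF n) -/(cB n) (addrC (drift _ _ _ _ _)) addrK.
    rewrite !sourceE /d.
    by field; rewrite psi_neq0 psi1_neq0 gt_eqF ?powR_gt0 ?w_gt0.
  have Wd0 : grid_cvg (fun n i j => Wn n i j * d n) (fun _ _ => 0).
    move=> i' j'; rewrite -(mulr0 (W i' j')); apply: cvgM => //; exact: WnW.
  have : kappa * Wn n i j + (kappa * Wn n i j * d n
        - drift (fun i j => Wn n i j * d n) i j (cF n) (cB n))
        + drift (fun i' j' => W i' j' - Wn n i' j') i j (cF n) (cB n)
        @[n --> \oo] --> kappa * W i j + (kappa * W i j * 0 - 0) + 0.
    apply: cvgD; last by apply: cvg_drift0 => //; exact: diff0.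
    apply: cvgD => //; apply: cvgB; last exact: cvg_drift0.
    exact: cvgM.
  rewrite mulr0 subr0 !addr0 => lim_kW.
  apply: (cvgr_to_le lim_kW); apply: nearW => n.
  apply: le_trans (opt_optimal W (U0 i j) (adm n)).
  by rewrite -sE driftB hW -/(cF n) -/(cB n); lra.
(* Conversely, the policy optimal at the limit is suboptimal along the sequence; being fixed, its
   drift and source pass to the limit. *)
- have dcvg : drift (Wn' n) i j (optF U W i j) (optB U W i j) @[n --> \oo]
      --> drift W i j (optF U W i j) (optB U W i j).
    apply/subr_cvg0.
    under eq_fun do rewrite -driftB.
    apply: (@cvg_drift0 _ i j (fun=> optF U W i j) (fun=> optB U W i j)) => //.
    exact: diff0.
  have scvg : source i j (Un n i j) (optF U W i j) (optB U W i j) @[n --> \oo]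
      --> source i j (U i j) (optF U W i j) (optB U W i j).
    under eq_fun do rewrite sourceE.
    by rewrite sourceE; apply: cvgMl_tmp; apply: cvg_powR => //; exact: w_gt0.
  have kcvg : kappa * Wn n i j
      + drift (fun i' j' => Wn' n i' j' - Wn n i' j') i j (cF n) (cB n)
      @[n --> \oo] --> kappa * W i j + 0.
    by apply: cvgD => //; apply: cvg_drift0 => //; exact: diff0.
  rewrite -[leRHS]addr0; apply: ler_cvg_to (cvgD dcvg scvg) kcvg _.
  apply: nearW => n; apply: le_trans (opt_optimal (Wn' n) (Un0 n i j) adm') _.
  by rewrite driftB hW -/(cF n) -/(cB n); lra.
Qed.

Lemma howard_iterates_exist U : (forall i j, U i j < 0) ->
  exists W cF cB : nat -> grid M, howard_iterates eps U W cF cB.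
Proof.
move=> U0; pose policy := (grid M * grid M)%type.
pose ok (c : policy) := forall i j, admissible i j (c.1 i j) (c.2 i j).
(* Choice requires a total solver; its value on inadmissible policies is a dummy. *)
have /choice[S hS] (c : policy) : exists W, ok c -> howard_linear U c.1 c.2 W.
  have [okc|] := pselect (ok c); last first.
    by move=> nok; exists (fun _ _ => 0).
  have [|W hW] := @linear_solvable c.1 c.2
    (fun i j => source i j (U i j) (c.1 i j) (c.2 i j)).
    by move=> i j; case: (okc i j) => /andP[_ ->] /andP[->].
  by exists W => _; apply/howard_linearE.
pose improve (c : policy) : policy := (optF U (S c), optB U (S c)).
pose pol n : policy := iter n improve (@cbar R M, @cbar R M).
have okpol n : ok (pol n).
  by elim: n => [|n _] i j; [exact: admissible_cbar|exact: admissible_opt].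
(* The predecessor makes [W n.+1] evaluate policy [n]; [W 0] is only a filler. *)
exists (fun n => S (pol n.-1)), (fun n => (pol n).1), (fun n => (pol n).2).
by split => // n; exact: hS.
Qed.

Lemma howard_iterates_admissible U (W cF cB : nat -> grid M) n i j :
  (forall i j, U i j < 0) ->
  howard_iterates eps U W cF cB -> admissible i j (cF n i j) (cB n i j).
Proof.
move=> U0 [cF0 cB0 _ cFS cBS]; case: n => [|n].
  by rewrite cF0 cB0; exact: admissible_cbar.
by rewrite cFS cBS; exact: admissible_opt.
Qed.

Lemma monotone_grid_cvg (W : nat -> grid M) (C : grid M) :
  (forall n, gridle (W n) (W n.+1)) -> (forall n, gridle (W n) C) ->
  exists V, grid_cvg W V.
Proof.
move=> incr ub; exists (fun i j => lim (W n i j @[n --> \oo])) => i j.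
apply: nondecreasing_is_cvgn.
  by apply/nondecreasing_seqP => n; exact: incr.
by exists (C i j) => _ [n _ <-]; exact: ub.
Qed.

Lemma howard_cvg U (W cF cB : nat -> grid M) : (forall i j, U i j < 0) ->
  howard_iterates eps U W cF cB ->
  exists2 V, grid_cvg W V & hjb_frozen eps U V.
Proof.
move=> U0 hW; have adm n i j := howard_iterates_admissible n i j U0 hW.
case: (hW) => _ _ hlin cFS cBS.
have {}hlin n i j := (howard_linearE U (cF n) (cB n) (W n.+1)).1 (hlin n) i j.
have UU : gridle U U by [].
(* Policy improvement: the policy optimal for [W n.+1] makes it a subsolution of the linear system
   solved by [W n.+2]. *)
have incr n : gridle (W n.+1) (W n.+2).
  apply: (@linear_comparison U U _ _ (cF n.+1) (cB n.+1)) => // i j.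
    by rewrite hlin cFS cBS; exact: opt_optimal.
  by rewrite -hlin.
(* Zero is a supersolution because every admissible source is nonpositive. *)
have ub n : gridle (W n.+1) (fun _ _ => 0).
  apply: (@linear_comparison U U _ _ (cF n) (cB n)) => // i j.
    by rewrite -hlin.
  rewrite mulr0 (_ : drift _ _ _ _ _ = 0) ?add0r ?source_le0//.
  by rewrite /drift /Dplus /Dminus; ring.
have [V WV] := monotone_grid_cvg incr ub.
exists V; first by move=> i j; rewrite -(cvg_shiftS (fun n => W n i j)); exact: WV.
apply: (@hjb_frozen_limit (fun=> U) (fun n => W n.+2) (fun n => W n.+1)) => //.
- by move=> i j; exact: cvg_cst.
- by move=> i j; rewrite (cvg_shiftS (fun n => W n.+1 i j)); exact: WV.
- move=> n i j; by rewrite hlin cFS cBS.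
Qed.

Lemma htk_step_exists U : (forall i j, U i j < 0) -> exists V, htk_step eps U V.
Proof.
move=> U0; have [W [cF [cB hW]]] := howard_iterates_exist U0.
have [V WV hV] := howard_cvg U0 hW.
by exists V; split=> //; exists W, cF, cB.
Qed.

(** * Barriers *)

Local Notation Ucheck := (@Defs.Ucheck R M).
Local Notation Vcheck := (@Defs.Vcheck R M).

Let powRD_gt0 (a s t : R) : 0 < a -> a `^ (s + t) = a `^ s * a `^ t.
Proof. by move=> a0; apply: powRD; rewrite (gt_eqF a0) implybT. Qed.

Local Notation m := (r M + psi M * (rho M - r M)).
(** Total wealth: the assets plus the higher income capitalised at rate [r]. *)
Local Notation A i := (x i + y M ord_max / r M).

Let r_gt0 : 0 < r M. Proof. by case/andP: hr. Qed.

Let gamma_lt0 : 1 - gamma M < 0. Proof. by rewrite subr_lt0. Qed.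

Let m_gt0 : 0 < m.
Proof.
case/andP: hr => r0 rrho; case/andP: hpsi => p0 _.
by rewrite addr_gt0// mulr_gt0// subr_gt0.
Qed.

Let b_gt0 : 0 < b M.
Proof. by rewrite mulr_gt0// powR_gt0// divr_gt0. Qed.

Let rA i : r M * A i = r M * x i + y M ord_max.
Proof. by field; rewrite gt_eqF. Qed.

Let A_gt0 i : 0 < A i.
Proof.
rewrite -(pmulr_rgt0 _ r_gt0) rA; apply: lt_trans (rx_y0_gt0 i) _.
by rewrite ltrD2l; case/andP: hy.
Qed.

Lemma cbar_le_rA i j : cbar i j <= r M * A i.
Proof. by rewrite rA lerD2l; case/andP: (y_bounds j). Qed.

Lemma Ucheck_w i j : w (Ucheck i j) = (r M * x i + y M ord0) `^ (1 - gamma M).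
Proof. by rewrite /Defs.Ucheck mulrC divfK// lt_eqF. Qed.

Lemma Vcheck_w i j : w (Vcheck i j) = (b M * A i) `^ (1 - gamma M).
Proof. by rewrite /Defs.Vcheck mulrC divfK// lt_eqF. Qed.

Lemma Vcheck_lt0 i j : Vcheck i j < 0.
Proof. by rewrite -(nmulr_rgt0 _ gamma_lt0) Vcheck_w powR_gt0// mulr_gt0. Qed.

Let theta_gamma : (1 - gamma M) * q = (1 - gamma M) - e.
Proof. by rewrite /theta; field; rewrite psi_neq0 lt_eqF. Qed.

Let kappaE v : kappa * v = rho M / e * w v.
Proof. by rewrite /theta; field; rewrite psi_neq0 psi1_neq0 lt_eqF. Qed.

Lemma F_marginal c v : 0 < c -> F M c v = c * marginal c v / e.
Proof.
move=> c0; rewrite /F /marginal powRD_gt0// (powRr1 (ltW c0)).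
by field; rewrite psi_neq0.
Qed.

(* [b] is normalised so that [m * A i] is the optimal consumption out of the
   wealth [A i] when the value is [Vcheck]; see [marginal_Vcheck]. *)
Lemma b_normalization : rho M * m `^ (- (psi M)^-1) * b M `^ (- e) = 1.
Proof.
rewrite /b powRM ?(ltW rho_gt0) ?powR_ge0// -powRrM.
rewrite (_ : (1 - psi M)^-1 * - e = (psi M)^-1); last first.
  by field; rewrite psi_neq0 subr_eq0 eq_sym -subr_eq0.
rewrite powRM ?invr_ge0 ?(ltW m_gt0) ?(ltW rho_gt0)// -(powR_inv1 (ltW rho_gt0)).
rewrite -powRrM [m `^ (- _)]powRN.
have rE : rho M `^ (- e) = (rho M)^-1 * rho M `^ (psi M)^-1.
  by rewrite -(powR_inv1 (ltW rho_gt0)) -powRD_gt0//; congr (_ `^ _); ring.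
rewrite rE mulN1r powRN.
by field; rewrite !gt_eqF ?powR_gt0.
Qed.

(** The derivative in [x] of the closed-form upper barrier. *)
Definition Vcheck_slope i : R := b M `^ (1 - gamma M) * A i `^ (- gamma M).

Lemma marginal_Vcheck i j : marginal (m * A i) (Vcheck i j) = Vcheck_slope i.
Proof.
have Ai := A_gt0 i.
rewrite /marginal Vcheck_w /Vcheck_slope -powRrM theta_gamma.
rewrite (powRM _ (ltW m_gt0) (ltW Ai)) (powRM _ (ltW b_gt0) (ltW Ai)).
rewrite (powRD_gt0 _ (- e) b_gt0).
have -> : A i `^ (- gamma M) = A i `^ (- (psi M)^-1) * A i `^ (1 - gamma M - e).
  by rewrite -powRD_gt0//; congr (_ `^ _); ring.
by rewrite -[RHS]mul1r -[X in _ = X * _]b_normalization; ring.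
Qed.

Lemma Vcheck_slope_gt0 i : 0 < Vcheck_slope i.
Proof. by rewrite mulr_gt0 ?powR_gt0. Qed.

Lemma Vcheck_tangent i i' j j' :
  Vcheck i' j' <= Vcheck i j + Vcheck_slope i * (x i' - x i).
Proof.
have := powR_tangent (ltW gamma_lt0) (A_gt0 i) (A_gt0 i').
rewrite (_ : 1 - gamma M - 1 = - gamma M); last by ring.
rewrite /Defs.Vcheck /Vcheck_slope !(powRM _ (ltW b_gt0) (ltW (A_gt0 _))) => h.
have /ler_wnM2l/(_ _ _ h) : b M `^ (1 - gamma M) / (1 - gamma M) <= 0.
  by rewrite ltW// pmulr_rlt0 ?invr_lt0 ?powR_gt0.
by congr (_ <= _); field; rewrite ?(gt_eqF r_gt0) lt_eqF.
Qed.

Lemma Dplus_Vcheck i j : (i < nx M)%N -> Dplus Vcheck i j <= Vcheck_slope i.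
Proof.
move=> inx; rewrite ler_pdivrMr// lerBlDl.
rewrite (_ : dx M = x (inord i.+1 : node M) - x i); first exact: Vcheck_tangent.
by rewrite /x inordK// -[i.+1]addn1 natrD; ring.
Qed.

Lemma Dminus_Vcheck i j : (0 < i)%N -> Vcheck_slope i <= Dminus Vcheck i j.
Proof.
move=> i0; rewrite ler_pdivlMr// lerBrDl -lerBrDr.
rewrite (_ : - (Vcheck_slope i * dx M) =
             Vcheck_slope i * (x (inord i.-1 : node M) - x i)).
  exact: Vcheck_tangent.
rewrite /x inordK; last by rewrite (leq_ltn_trans (leq_pred _)).
by rewrite -{2}(prednK i0) -[i.-1.+1]addn1 natrD; ring.
Qed.

(** Concavity of the barrier lets its slope replace both one-sided differences. What remains is the
    unconstrained consumption problem with the higher income, whose value is [Vcheck] and whose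
    optimal consumption is [m * A i]. *)
Lemma Vcheck_supersolution i j cF cB : admissible i j cF cB ->
  drift Vcheck i j cF cB + source i j (Vcheck i j) cF cB <= kappa * Vcheck i j.
Proof.
case=> /andP[cF0 cFle] /andP[cBge cBle] hF hB.
have Ai := A_gt0 i; have p0 := Vcheck_slope_gt0 i.
have mA0 : 0 < m * A i by rewrite mulr_gt0.
have cb0 := cbar_gt0 i j; have cB0 := lt_le_trans cb0 cBge.
set p := Vcheck_slope i in p0 *.
set v := Vcheck i j.
have dF : (cbar i j - cF) * Dplus Vcheck i j <= (cbar i j - cF) * p.
  case/orP: hF => [inx|/eqP ->]; last by rewrite subrr !mul0r.
  by rewrite ler_wpM2l ?subr_ge0// Dplus_Vcheck.
have dB : (cbar i j - cB) * Dminus Vcheck i j <= (cbar i j - cB) * p.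
  case/orP: hB => [i0|/eqP ->]; last by rewrite subrr !mul0r.
  by rewrite ler_wnM2l ?subr_le0// Dminus_Vcheck.
have mp : marginal (m * A i) v = p := marginal_Vcheck i j.
have opt c : 0 < c -> F M c v - c * p <= F M (m * A i) v - m * A i * p.
  by move=> c0; apply: F_sub_linear_le; rewrite // mp.
have value : r M * A i * p + F M (m * A i) v - m * A i * p = kappa * v.
  have wE : w v = A i * p.
    rewrite /v Vcheck_w (powRM _ (ltW b_gt0) (ltW Ai)) /p /Vcheck_slope.
    by rewrite (powRD_gt0 _ _ Ai) (powRr1 (ltW Ai)); ring.
  rewrite F_marginal// mp kappaE wE.
  by field; rewrite psi_neq0 psi1_neq0 gt_eqF.
have cbp : cbar i j * p <= r M * A i * p by rewrite ler_wpM2r ?(ltW p0) ?cbar_le_rA.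
have l0 : lambda M j * (Vcheck i (rev_ord j) - Vcheck i j) = 0.
  by rewrite /Defs.Vcheck subrr mulr0.
rewrite /drift /source l0 -/v -value.
(* Since [cF <= cbar <= cB], one of the two policies lies on the far side of [cbar] from the
   optimum. It does no better than [cbar], whose term is subtracted; [opt] handles the other. *)
case: (leP (m * A i) (cbar i j)) => mAc.
  have hcB : F M cB v - cB * p <= F M (cbar i j) v - cbar i j * p.
    apply: F_sub_linear_le => //; last first.
      by move=> /lt_le_trans/(_ cBge); rewrite ltxx.
    by rewrite -mp marginal_anti.
  by have := opt _ cF0; lra.
have hcF : F M cF v - cF * p <= F M (cbar i j) v - cbar i j * p.
  apply: F_sub_linear_le => //; first by move=> /lt_le_trans/(_ cFle); rewrite ltxx.
  by rewrite -mp marginal_anti// ltW.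
by have := opt _ cB0; lra.
Qed.

(** * The lower barrier and the ordering of the barriers *)

Lemma Ucheck_lt0 i j : Ucheck i j < 0.
Proof. by rewrite -(nmulr_rgt0 _ gamma_lt0) Ucheck_w powR_gt0// rx_y0_gt0. Qed.

(** Tested with the policy of consuming [cbar]: asset drifts vanish, the switching term is zero
    because the barrier ignores income, and [cbar] is at least the consumption that [Ucheck]
    values. *)
Lemma Ucheck_subsolution i j :
  kappa * Ucheck i j <=
  drift Ucheck i j (optF Ucheck Ucheck i j) (optB Ucheck Ucheck i j)
  + source i j (Ucheck i j) (optF Ucheck Ucheck i j) (optB Ucheck Ucheck i j).
Proof.
have C0 := rx_y0_gt0 i.
apply: le_trans (opt_optimal Ucheck (Ucheck_lt0 i j) (admissible_cbar i j)).
have -> : kappa * Ucheck i j = F M (r M * x i + y M ord0) (Ucheck i j).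
  rewrite kappaE /F Ucheck_w -powRrM theta_gamma -[RHS]mulrA -powRD_gt0//.
  by congr (_ * _ `^ _); ring.
have /(F_homo (Ucheck i j) C0) : r M * x i + y M ord0 <= cbar i j.
  by rewrite lerD2l; case/andP: (y_bounds j).
rewrite /drift /source (_ : Ucheck i (rev_ord j) = Ucheck i j)//; lra.
Qed.

(** Divided by [rho] and raised to the power [1 - psi], this is [powR_le_chord] at [r / rho]. *)
Let r_le_b : r M <= b M.
Proof.
case/andP: hr => r0 rrho; case/andP: hpsi => p0 p1.
have s0 : 0 < 1 - psi M by rewrite subr_gt0.
rewrite /b mulrC -ler_pdivrMr//.
have rr0 : 0 <= r M / rho M by rewrite divr_ge0// ltW.
have -> : r M / rho M = ((r M / rho M) `^ (1 - psi M)) `^ (1 - psi M)^-1.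
  by rewrite -powRrM mulfV ?gt_eqF// powRr1.
apply: ge0_ler_powR; first by rewrite invr_ge0 ltW.
- by rewrite nnegrE powR_ge0.
- by rewrite nnegrE divr_ge0// ltW.
have s01 : 0 < 1 - psi M < 1 by rewrite s0 ltrBlDr ltrDl.
apply: le_trans (powR_le_chord s01 rr0) _.
by rewrite le_eqVlt; apply/orP; left; apply/eqP; field; rewrite gt_eqF.
Qed.

Lemma Ucheck_le_Vcheck : gridle Ucheck Vcheck.
Proof.
move=> i j; rewrite /Defs.Ucheck /Defs.Vcheck ler_nM2r ?invr_lt0//.
apply: nonincreasing_powR; [exact: ltW|exact: rx_y0_gt0|].
apply: (@le_trans _ _ (r M * A i)); last first.
  by rewrite ler_wpM2r ?r_le_b ?(ltW (A_gt0 i)).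
by rewrite rA lerD2l; case/andP: (y_bounds ord0).
Qed.

Lemma le_Vcheck_lt0 U i j : gridle U Vcheck -> U i j < 0.
Proof. by move=> /(_ i j) /le_lt_trans; apply; exact: Vcheck_lt0. Qed.

Lemma hjb_frozen_le_Vcheck U V : gridle U Vcheck ->
  hjb_frozen eps U V -> gridle V Vcheck.
Proof.
move=> UV /hjb_frozenE hV; apply: (frozen_comparison UV Vcheck_lt0).
  by move=> i j; rewrite hV.
exact: Vcheck_supersolution.
Qed.

Lemma hjb_frozen_ge_Ucheck U V : gridle Ucheck U -> gridle U Vcheck ->
  hjb_frozen eps U V -> gridle Ucheck V.
Proof.
move=> UU UV hV; have U0 i j := le_Vcheck_lt0 i j UV.
apply: (frozen_comparison UU U0 Ucheck_subsolution) => i j cF cB.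
exact: hjb_frozen_supersolution.
Qed.

(** * The outer iteration *)

Lemma htk_sequence_le_Vcheck (V : nat -> grid M) k :
  htk_sequence eps V -> gridle (V k) Vcheck.
Proof.
move=> [V0 VS]; elim: k => [|k IH]; first by rewrite V0.
by apply: (hjb_frozen_le_Vcheck IH); case: (VS k).
Qed.

(** The algorithm is well defined: Howard's method supplies each step, comparison makes its result
    unique, and the iterates stay below [Vcheck], hence negative. *)
Lemma htk_sequence_unique : exists! V : nat -> grid M, htk_sequence eps V.
Proof.
have /choice[T hT] U : exists V, gridle U Vcheck -> htk_step eps U V.
  have [UV|nUV] := pselect (gridle U Vcheck); last first.
    by exists U.
  have [V hV] := htk_step_exists (fun i j => le_Vcheck_lt0 i j UV).
  by exists V.
have le_iter k : gridle (iter k T Vcheck) Vcheck.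
  elim: k => [//|k IH] /=.
  by apply: (hjb_frozen_le_Vcheck IH); case: (hT _ IH).
exists (fun k => iter k T Vcheck); split.
  by split=> // k; exact: hT.
move=> V hV; apply/funext; elim=> [|k IH]; first by case: hV.
have V0 := fun i j => le_Vcheck_lt0 i j (htk_sequence_le_Vcheck k hV).
apply: (hjb_frozen_uniq V0); last by case: hV => _ /(_ k)[].
by rewrite -IH; case: (hT _ (le_iter k)).
Qed.

Lemma htk_sequence_cvg (V : nat -> grid M) : htk_sequence eps V ->
  exists2 Vbar : grid M, maximal_solution eps Vbar & grid_cvg V Vbar.
Proof.
move=> hV; have leV k := htk_sequence_le_Vcheck k hV.
have V_lt0 k i j := le_Vcheck_lt0 i j (leV k).
case: (hV) => V0 VS; have {}VS k : hjb_frozen eps (V k) (V k.+1) by case: (VS k).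
have geU k : gridle Ucheck (V k).
  elim: k => [|k IH]; first by rewrite V0; exact: Ucheck_le_Vcheck.
  exact: hjb_frozen_ge_Ucheck IH (leV k) (VS k).
have decr k : gridle (V k.+1) (V k).
  elim: k => [|k IH]; first by rewrite V0.
  exact: hjb_frozen_homo IH (V_lt0 k) (VS k.+1) (VS k).
(* The sequence decreases, so the increasing case is applied to its opposite. *)
have [V' V'cvg] : exists V', grid_cvg (fun k i j => - V k i j) V'.
  apply: (@monotone_grid_cvg _ (fun i j => - Ucheck i j)) => k i j.
    by rewrite lerN2 decr.
  by rewrite lerN2 geU.
pose Vbar : grid M := fun i j => - V' i j.
have Vcvg : grid_cvg V Vbar.
  move=> i j; rewrite (_ : (fun k => V k i j) = - (fun k => - V k i j)).
    exact: cvgN.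
  by apply/funext => k; rewrite fctE opprK.
exists Vbar => //.
have le_lim W : (forall k, gridle W (V k)) -> gridle W Vbar.
  by move=> WV i j; apply: cvgr_to_ge (Vcvg i j) _; apply: nearW => k; exact: WV.
have Vbar_le : gridle Vbar Vcheck.
  by move=> i j; apply: cvgr_to_le (Vcvg i j) _; apply: nearW => k; exact: leV.
split.
  split=> //; last exact: le_lim.
  have Vcvg' : grid_cvg (fun k => V k.+1) Vbar.
    by move=> i j; rewrite (cvg_shiftS (fun k => V k i j)); exact: Vcvg.
  apply: (hjb_frozen_limit V_lt0 _ Vcvg Vcvg' Vcvg').
    by move=> i j; exact: le_Vcheck_lt0.
  by move=> k; apply/hjb_frozenE.
(* A solution is its own outer step, so monotonicity of the step keeps it below every iterate. *)
move=> W [hW _ WV]; apply: le_lim; elim=> [|k IH]; first by rewrite V0.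
exact: hjb_frozen_homo IH (V_lt0 k) hW (VS k).
Qed.

End HTK.

Theorem theorem5p12 (R : realType) (M : model R) (eps : R)
  (hgamma : 1 < gamma M)
  (hpsi : 0 < psi M < 1)
  (hr : 0 < r M < rho M)
  (hy : 0 < y M ord0 < y M ord_max)
  (hlambda : forall j, 0 < lambda M j)
  (hxlo : 0 < rho M * xlo M + y M ord0)
  (hx : xlo M <= 0 < xhi M)
  (hnx : (1 <= nx M)%N)
  (htheta : 0 < theta M < 1)
  (heps : 0 < eps)
  (heps_inv : r M * xhi M + y M ord_max < eps^-1) :
  (exists! V : nat -> grid M, htk_sequence eps V) /\
  (forall V : nat -> grid M, htk_sequence eps V ->
     exists2 Vbar : grid M, maximal_solution eps Vbar & grid_cvg V Vbar).
Proof.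
split; first exact: htk_sequence_unique.
exact: htk_sequence_cvg.
Qed.
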